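(* Let $I\subseteq\mathbb{R}$ be an open interval, let $w=(w_1,w_2,w_3):I\to\mathbb{R}^3$ and $\alpha:I\to[0,1]$ be differentiable functions, and let $t\in I$ be such that $\|w(t)\|_{\alpha(t)}\neq 0$. Then $$\frac{d}{dt}\|w(t)\|_{\alpha(t)}\ \le\ \|\dot w(t)\|_{\alpha(t)}+|\dot\alpha(t)|\,\frac{|w_2(t)w_3(t)|}{\|w(t)\|_{\alpha(t)}} .$$
   Context: For $a\in[0,1]$ and $w=(w_1,w_2,w_3)\in\mathbb{R}^3$, $\|w\|_a=\sqrt{w_1^2+w_2^2+w_3^2-2(1-a)w_2w_3}$. A dot denotes the derivative with respect to $t$. *)

(* Defs.v *)
From HB Require Import structures.
From mathcomp Require Import all_boot all_order all_algebra.
From mathcomp Require Import all_classical all_reals all_analysis.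

Set Implicit Arguments.
Unset Strict Implicit.
Unset Printing Implicit Defensive.

Import Order.TTheory GRing.Theory Num.Theory.
Import numFieldNormedType.Exports.

Local Open Scope ring_scope.

(* The coordinates (w_1, w_2, w_3) are numbered from 0: w_(j+1) is [w 0 j].
   The radicand is nonnegative for 0 <= a <= 1, so the convention that
   [Num.sqrt] is 0 on negative numbers plays no role in that range. *)
Definition anorm (R : realType) (a : R) (w : 'rV[R]_3) : R :=
  Num.sqrt (w 0 0 ^+ 2 + w 0 1 ^+ 2 + w 0 2 ^+ 2
            - 2 * (1 - a) * w 0 1 * w 0 2).

(* Main.v *)
Require Import Defs.
From HB Require Import structures.
From mathcomp Require Import all_boot all_order all_algebra.
From mathcomp Require Import all_classical all_reals all_analysis.
From mathcomp Require Import ring lra.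

Import Order.TTheory GRing.Theory Num.Theory.
Import numFieldNormedType.Exports.

Local Open Scope ring_scope.

(** Write [adot a] for the symmetric bilinear form whose diagonal is the
    radicand of [anorm a].  Where the radicand is positive the norm is
    differentiable by the chain rule, and the derivative of
    [anorm (alpha s) (w s) = sqrt (adot (alpha s) (w s) (w s))] is
      [(adot alpha w w' + alpha' w_2 w_3) / anorm alpha w]:
    differentiating the two vector slots gives [2 adot alpha w w'], and
    differentiating the parameter gives [2 alpha' w_2 w_3]
    ([is_derive_anorm]).  For [0 <= alpha <= 1] the form is positive
    semidefinite, so the Cauchy-Schwarz inequality [adot_le_anormM] bounds
    the first quotient by [anorm alpha w'], and the second one is at most its
    absolute value. *)

Definition adot {R : realType} (a : R) (u v : 'rV[R]_3) : R :=
  u 0 0 * v 0 0 + u 0 1 * v 0 1 + u 0 2 * v 0 2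
  - (1 - a) * (u 0 1 * v 0 2 + u 0 2 * v 0 1).

Lemma anormE (R : realType) (a : R) (v : 'rV[R]_3) :
  anorm a v = Num.sqrt (adot a v v).
Proof. by rewrite /anorm /adot; congr Num.sqrt; ring. Qed.

(** With [c = 1 - a] in [[0, 1]], completing the square leaves
    [v_1 ^ 2 + (v_2 - c v_3) ^ 2 + (1 - c ^ 2) v_3 ^ 2]. *)
Lemma adot_ge0 (R : realType) (a : R) (v : 'rV[R]_3) :
  0 <= a <= 1 -> 0 <= adot a v v.
Proof.
move=> /andP[a0 a1].
have -> : adot a v v = v 0 0 ^+ 2 + (v 0 1 - (1 - a) * v 0 2) ^+ 2
    + a * (2 - a) * v 0 2 ^+ 2 by rewrite /adot; ring.
have a2 : 0 <= 2 - a by lra.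
by rewrite !addr_ge0 ?sqr_ge0// (mulr_ge0 (mulr_ge0 a0 a2))// sqr_ge0.
Qed.

(** Lagrange's identity for the form [adot a]: the difference of the two sides
    is the form that [adot a] induces on bivectors, evaluated at the 2x2 minors
    of the pair [u], [v].  That form is again a sum of nonnegative terms. *)
Lemma adot_cauchy_schwarz (R : realType) (a : R) (u v : 'rV[R]_3) :
  0 <= a <= 1 -> adot a u v ^+ 2 <= adot a u u * adot a v v.
Proof.
move=> /andP[a0 a1]; rewrite -subr_ge0.
pose m i j := u 0 i * v 0 j - u 0 j * v 0 i.
have -> : adot a u u * adot a v v - adot a u v ^+ 2 =
    (m 0 1 - (1 - a) * m 0 2) ^+ 2
    + a * (2 - a) * (m 0 2 ^+ 2 + m 1 2 ^+ 2) by rewrite /adot /m; ring.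
have a2 : 0 <= 2 - a by lra.
rewrite addr_ge0 ?sqr_ge0// (mulr_ge0 (mulr_ge0 a0 a2))//.
by rewrite addr_ge0 ?sqr_ge0.
Qed.

Lemma adot_le_anormM (R : realType) (a : R) (u v : 'rV[R]_3) :
  0 <= a <= 1 -> adot a u v <= anorm a u * anorm a v.
Proof.
move=> a01; rewrite !anormE -sqrtrM ?adot_ge0//.
apply: le_trans (ler_norm _) _.
by rewrite -sqrtr_sqr ler_wsqrtr// adot_cauchy_schwarz.
Qed.

Lemma is_derive_coord (R : realType) (w : R -> 'rV[R]_3) (t : R) (i : 'I_3) :
  derivable w t 1 -> is_derive t 1 (fun s => w s 0 i) (derive1 w t 0 i).
Proof.
move=> dw; have /derivable_mxP dwi := dw.
by apply: DeriveDef; rewrite // derive1E derive_mx// mxE.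
Qed.

Lemma is_derive_anorm (R : realType) (w : R -> 'rV[R]_3) (alpha : R -> R)
    (t : R) :
  derivable w t 1 -> derivable alpha t 1 -> anorm (alpha t) (w t) != 0 ->
  is_derive t 1 (fun s => anorm (alpha s) (w s))
    ((adot (alpha t) (w t) (derive1 w t)
      + derive1 alpha t * (w t 0 1 * w t 0 2)) / anorm (alpha t) (w t)).
Proof.
move=> dw dalpha n0.
have q_gt0 : 0 < adot (alpha t) (w t) (w t).
  by move: n0; rewrite anormE sqrtr_eq0 -ltNge.
have d0 := is_derive_coord _ _ _ 0 dw.
have d1 := is_derive_coord _ _ _ 1 dw.
have d2 := is_derive_coord _ _ _ 2 dw.
have da : is_derive t 1 alpha (derive1 alpha t).
  by apply: DeriveDef; rewrite // derive1E.
have dq : is_derive t 1 (fun s => adot (alpha s) (w s) (w s))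
    (2 * (adot (alpha t) (w t) (derive1 w t)
          + derive1 alpha t * (w t 0 1 * w t 0 2))).
  rewrite /adot.
  by apply: is_derive_eq; rewrite /GRing.scale /=; ring.
have ds := is_derive1_sqrt q_gt0.
rewrite (_ : (fun s => anorm _ _) =
  Num.sqrt \o (fun s => adot (alpha s) (w s) (w s))); last first.
  by apply/funext => s; rewrite anormE.
apply: is_derive_eq.
have s0 : Num.sqrt (adot (alpha t) (w t) (w t)) != 0 by rewrite -anormE.
by rewrite anormE; field.
Qed.

Theorem mainTheorem4 (R : realType) (I : set R)
    (w : R -> 'rV[R]_3) (alpha : R -> R) (t : R)
    (I_open : open I) (I_itv : is_interval I)
    (alpha01 : forall s, I s -> 0 <= alpha s <= 1)
    (w_diff : forall s, I s -> derivable w s 1)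
    (alpha_diff : forall s, I s -> derivable alpha s 1)
    (It : I t)
    (norm_neq0 : anorm (alpha t) (w t) != 0) :
  derivable (fun s => anorm (alpha s) (w s)) t 1 /\
  derive1 (fun s => anorm (alpha s) (w s)) t
    <= anorm (alpha t) (derive1 w t)
       + `|derive1 alpha t| * (`|w t 0 1 * w t 0 2| / anorm (alpha t) (w t)).
Proof.
have a01 := alpha01 t It.
have dn := is_derive_anorm _ _ _ _ (w_diff t It) (alpha_diff t It) norm_neq0.
have n_gt0 : 0 < anorm (alpha t) (w t) by rewrite lt0r norm_neq0 sqrtr_ge0.
split; first exact: ex_derive.
rewrite derive1E derive_val mulrDl lerD//.
  by rewrite ler_pdivrMr// mulrC adot_le_anormM.
by rewrite [leRHS]mulrA ler_pM2r ?invr_gt0// -normrM ler_norm.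
Qed.
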